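(* There is a bounded Borel measurable function $\pi:\mathbb{R}\times\mathbb{R}\to\mathbb{R}$ whose best response relation $$E^\pi=\{(s,\mu)\in\mathbb{R}\times\Delta(\mathbb{R}) : \forall t\in\mathbb{R}\ \ \pi(s,\mu)\ge\pi(t,\mu)\}$$ is not Borel. Moreover, $\pi$ can be taken to be of Baire class two.
   Context: $\Delta(\mathbb{R})$ is the Polish space of Borel probability measures on $\mathbb{R}$ (weak topology), and $\pi(s,\mu)=\int_{\mathbb{R}}\pi(s,y)\,d\mu(y)$. Baire class two means a pointwise limit of a sequence of Baire class one functions (which are pointwise limits of sequences of continuous functions). *)

(* Defs.v *)
From HB Require Import structures.
From mathcomp Require Import all_boot all_order all_algebra.
From mathcomp Require Import all_classical all_reals all_analysis.

Set Implicit Arguments.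
Unset Strict Implicit.
Unset Printing Implicit Defensive.
Import Order.TTheory GRing.Theory Num.Theory.
Import numFieldNormedType.Exports.
Local Open Scope classical_set_scope.
Local Open Scope ring_scope.

HB.instance Definition _ (S T : ptopologicalType) := Pointed.on (S * T)%type.

Definition borelType (T : ptopologicalType) := g_sigma_algebraType (@open T).

Fixpoint baire_class (X Y : topologicalType) (n : nat) : set (X -> Y) :=
  match n with
  | 0 => [set f | continuous f]
  | m.+1 => [set f | exists2 u : nat -> X -> Y,
      (forall k, baire_class m (u k)) &
      (forall x, u k x @[k --> \oo] --> f x)]
  end.

Definition bounded_continuous (R : realType) :=
  {f : R -> R | continuous f /\ bounded_fun f}.

Definition integral_ev (R : realType) (mu : probability (measurableTypeR R) R) :
    {ptws bounded_continuous R -> R} :=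
  fun f => \int[mu]_y sval f y.

(* The initial topology for the maps mu |-> \int f dmu, f bounded continuous,
   is the weak topology.  A probability measure is here a function on all sets
   of reals, constrained on the Borel ones only; measures that agree on Borel
   sets have the same integrals, so they belong to the same open, hence to the
   same Borel sets, and this space has exactly the Borel sets of its Kolmogorov
   quotient, the Polish space of Borel probability measures. *)
Definition Delta (R : realType) := initial_topology (@integral_ev R).

HB.instance Definition _ (R : realType) := Topological.on (Delta R).
HB.instance Definition _ (R : realType) := Pointed.on (Delta R).

Definition expected_payoff (R : realType) (f : R * R -> R) (s : R)
    (mu : Delta R) : R :=
  \int[(mu : probability (measurableTypeR R) R)]_y f (s, y).

Definition best_response (R : realType) (f : R * R -> R) : set (R * Delta R) :=
  [set p | forall t, expected_payoff f t p.2 <= expected_payoff f p.1 p.2].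

(* Main.v *)
(* Against the Dirac mass at [y], a strategy [t] earns [f (t, y)].  If [f] is the
   indicator of a set [W] that contains no point with first coordinate [-1], then
   [-1] earns 0 and is a best response to the Dirac mass at [y] exactly when [y]
   is not in the projection of [W].  So it suffices to find a G_delta set [W],
   whose indicator is of Baire class two, with a non-Borel projection.  Cantor's
   diagonal argument gives an analytic subset of the Cantor space whose complement
   is not analytic, hence not Borel; it is the projection of a G_delta set, which
   is carried to the plane by the embedding of the Cantor space in the reals by
   ternary expansions. *)
Require Import Defs.
From mathcomp Require Import all_boot all_order all_algebra.
From mathcomp Require Import all_classical all_reals all_analysis.
From mathcomp Require Import measurable_realfun.
From mathcomp Require Import lra.
Import Order.TTheory GRing.Theory Num.Theory.
Import numFieldNormedType.Exports.
Local Open Scope classical_set_scope.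
Local Open Scope ring_scope.

(** * Continuity for products and spaces of pointwise convergence *)

Lemma continuous_pair (T U V : topologicalType) (f : T -> U) (g : T -> V) :
  continuous f -> continuous g -> continuous (fun t => (f t, g t)).
Proof. by move=> fc gc t; exact: cvg_pair (fc t) (gc t). Qed.

Lemma open_preimage (T U : topologicalType) (f : T -> U) (A : set U) :
  continuous f -> open A -> open (f @^-1` A).
Proof. by move=> fc oA; apply: open_comp oA => t _; exact: fc. Qed.

Lemma continuous_comp_fst (T U V : topologicalType) (f : T -> V) :
  continuous f -> continuous (fun p : T * U => f p.1).
Proof.
by move=> fc p; apply: (@continuous_comp _ _ _ fst f p cvg_fst); exact: fc.
Qed.

Lemma continuous_comp_snd (T U V : topologicalType) (f : U -> V) :
  continuous f -> continuous (fun p : T * U => f p.2).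
Proof.
by move=> fc p; apply: (@continuous_comp _ _ _ snd f p cvg_snd); exact: fc.
Qed.

Lemma cvg_ptws (I : Type) (V : topologicalType) (F : set_system {ptws I -> V})
    (x : {ptws I -> V}) : Filter F ->
  (forall i, (fun y : {ptws I -> V} => y i) @ F --> x i) -> F --> x.
Proof.
move=> FF Fx; apply/cvg_sup => i U [_ [[W oW <-] Wx]] /filterS; apply.
by apply: Fx; apply: open_nbhs_nbhs.
Qed.

Lemma continuous_ptws (I : Type) (T V : topologicalType) (f : T -> {ptws I -> V}) :
  (forall i, continuous (fun t => f t i)) -> continuous f.
Proof. by move=> fc t; apply: cvg_ptws => i; exact: fc. Qed.

(** * Cylinders in the Cantor space *)

Lemma coord_continuous i : continuous (fun x : cantor_space => x i).
Proof. exact: (@proj_continuous nat (fun=> bool) i). Qed.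

Lemma mkseq_ext (T : Type) (x y : nat -> T) m :
  mkseq x m = mkseq y m -> forall i, (i < m)%N -> x i = y i.
Proof.
move=> xy i im; have := congr1 (fun s => nth (x i) s i) xy.
by rewrite !nth_mkseq.
Qed.

Lemma near_prefix (x : cantor_space) m :
  \forall y \near x, mkseq y m = mkseq x m.
Proof.
elim: m => [|m IH]; first exact: filterE.
have : \forall y \near x, y m = x m.
  exact: (coord_continuous m x _ (discrete_set1 (x m))).
apply: filterS2 IH => y ym ymx.
by rewrite !mkseqS ym ymx.
Qed.

(** Otherwise each [m] has a point [y m] outside [A] with the same first [m] digits as [x]; these
    points converge to [x] coordinatewise. *)
Lemma nbhs_prefix (x : cantor_space) (A : set cantor_space) : nbhs x A ->
  exists m, forall y, mkseq y m = mkseq x m -> A y.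
Proof.
move=> xA; apply: contrapT => /forallNP nA.
have /choice[y yP] m : exists y : cantor_space, mkseq y m = mkseq x m /\ ~ A y.
  by have /existsNP[y /not_implyP] := nA m; exists y.
suff /(_ A xA)[m _ /(_ m (leqnn m))] : y @ \oo --> x by case: (yP m).
apply: cvg_ptws => i U /nbhs_singleton Ux; exists i.+1 => // m /= im.
by rewrite /= (mkseq_ext _ _ _ _ (yP m).1).
Qed.

Lemma mkseq_prefixW (x y : cantor_space) m n : (m <= n)%N ->
  mkseq x n = mkseq y n -> mkseq x m = mkseq y m.
Proof.
move=> mn xy; apply/eq_in_map => i; rewrite mem_iota => /andP[_ im].
by apply: mkseq_ext xy _ _; exact: leq_trans im mn.
Qed.

Lemma openP_prefix (A : set (cantor_space * cantor_space)) : open A <->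
  (forall p, A p -> exists m, forall q,
    mkseq q.1 m = mkseq p.1 m -> mkseq q.2 m = mkseq p.2 m -> A q).
Proof.
rewrite openE; split=> [oA p /oA|].
  case=> [[P Q]] /= [/nbhs_prefix[m mP] /nbhs_prefix[n nQ]] PQA.
  exists (maxn m n) => q q1 q2; apply: PQA; split => /=.
    by apply: mP; apply: mkseq_prefixW q1; rewrite leq_maxl.
  by apply: nQ; apply: mkseq_prefixW q2; rewrite leq_maxr.
move=> AP p /AP[m mA].
exists ([set y | mkseq y m = mkseq p.1 m], [set y | mkseq y m = mkseq p.2 m]).
  by split; exact: near_prefix.
by move=> q [q1 q2]; exact: mA.
Qed.

(** * Analytic subsets of the Cantor space *)

(** Projections of G_delta sets: projecting closed sets of the compact square would give closed sets
    only. *)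
Definition analytic (A : set cantor_space) :=
  exists2 U : nat -> set (cantor_space * cantor_space),
    forall n, open (U n) & A = [set x | exists z, forall n, U n (x, z)].

(** Numbers that code no index impose the trivial condition [setT]. *)
Lemma analytic_count (I : countType)
    (U : I -> set (cantor_space * cantor_space)) :
  (forall i, open (U i)) -> analytic [set x | exists z, forall i, U i (x, z)].
Proof.
move=> oU; exists (fun n => oapp U setT (unpickle n)).
  by move=> n; case: unpickle => [i|]; [exact: oU|exact: openT].
apply/seteqP; split=> x [z xz]; exists z => n; first by case: unpickle => /=.
by have := xz (pickle n); rewrite pickleK.
Qed.

(** Through the pairing of indices, one point of the Cantor space codes a sequence of points. *)
Definition slice (i : nat) (z : cantor_space) : cantor_space :=
  fun k => z (pickle (i, k)).

Lemma slice_continuous i : continuous (slice i).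
Proof. by apply: continuous_ptws => k; exact: coord_continuous. Qed.

Lemma slice_surj (u : nat -> cantor_space) : exists z, forall i, slice i z = u i.
Proof.
exists (fun n => if unpickle n is Some (i, k) then u i k else false) => i.
by apply/funext => k; rewrite /slice pickleK.
Qed.

Lemma open_preim_slice i (V : set (cantor_space * cantor_space)) : open V ->
  open [set p : cantor_space * cantor_space | V (p.1, slice i p.2)].
Proof.
move=> oV.
apply: (@open_preimage _ _ (fun p => (p.1, slice i p.2)) V) oV => //.
apply: continuous_pair.
  by apply: (@continuous_comp_fst _ _ _ id) => p; exact: cvg_id.
by apply: continuous_comp_snd; exact: slice_continuous.
Qed.

(** The slices of a single witness are witnesses for all the [A i], so the open conditions are
    indexed by pairs. *)
Lemma analytic_bigcap (A : nat -> set cantor_space) :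
  (forall i, analytic (A i)) -> analytic (\bigcap_i A i).
Proof.
move=> /(_ _)/cid2-/all_sig2[U oU AU].
rewrite (_ : \bigcap_i _ = [set x | exists z, forall k : nat * nat,
    [set p | U k.1 k.2 (p.1, slice k.1 p.2)] (x, z)]).
  apply: (@analytic_count _ (fun k => [set p | U k.1 k.2 (p.1, slice k.1 p.2)])).
  by move=> k; exact: open_preim_slice.
apply/seteqP; split=> x; last first.
  by move=> [z xz] i _; rewrite AU; exists (slice i z) => n; exact: (xz (i, n)).
move=> Ax; have /choice[z zP] i : exists z, forall n, U i n (x, z).
  by have := Ax i Logic.I; rewrite AU.
by have [w wz] := slice_surj z; exists w => -[i n] /=; rewrite wz.
Qed.

(* A witness for the union is a pair of a nonempty set [w] of indices and a [z]
   that is a witness for all the indices in [w]: no condition on [w] selects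
   a single index, so that all conditions are open. *)
Lemma analytic_bigcup (A : nat -> set cantor_space) :
  (forall i, analytic (A i)) -> analytic (\bigcup_i A i).
Proof.
move=> /(_ _)/cid2-/all_sig2[U oU AU].
pose V (k : option (nat * nat)) : set (cantor_space * cantor_space) :=
  if k is Some (i, n) then
    [set p | slice 0 p.2 i = false] `|` [set p | U i n (p.1, slice 1 p.2)]
  else \bigcup_i [set p | slice 0 p.2 i = true].
have slice_open i b :
    open [set p : cantor_space * cantor_space | slice 0 p.2 i = b].
  apply: (@open_preimage _ _ (fun p => slice 0 p.2 i) [set b]).
    exact: continuous_comp_snd (coord_continuous (pickle (0%N, i))).
  exact: discrete_open.
rewrite (_ : \bigcup_i _ = [set x | exists z, forall k, V k (x, z)]).
  apply: analytic_count; case=> [[i n]|] /=; last exact: bigcup_open.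
  by apply: openU; [exact: slice_open|exact: open_preim_slice].
apply/seteqP; split=> x.
  move=> [i _]; rewrite AU => -[z xz].
  (* Slice 0 is the singleton of [i], and all other slices are [z]. *)
  have [w wP] := slice_surj (fun j => if j == 0 then fun k => k == i else z).
  exists w => -[[j n]|] /=; last by exists i => //=; rewrite wP /= eqxx.
  by rewrite !wP /=; have [->|] := eqVneq j i; [right|left].
move=> [z xz]; have [i _ /= zi] := xz None; exists i => //.
rewrite AU; exists (slice 1 z) => n.
by have [/=|//] := xz (Some (i, n)); rewrite zi.
Qed.

Lemma analytic_open (A : set cantor_space) : open A -> analytic A.
Proof.
move=> oA; exists (fun=> fst @^-1` A) => [_|].
  by apply: open_preimage oA => p; exact: cvg_fst.
apply/seteqP; split=> [x Ax|x [z xz]]; last exact: (xz 0).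
by exists point.
Qed.

(** A closed set is the intersection over [m] of the open sets [B m] of points that share their
    first [m] digits with one of its points. *)
Lemma analytic_closed (A : set cantor_space) : closed A -> analytic A.
Proof.
move=> cA.
pose B m := [set x | exists2 y, A y & mkseq y m = mkseq x m].
rewrite (_ : A = \bigcap_m B m).
  apply: analytic_bigcap => m; apply: analytic_open; rewrite openE.
  move=> x [y Ay yx]; apply: filterS (near_prefix x m) => z zx.
  by exists y => //; rewrite yx.
apply/seteqP; split=> [x Ax m _|x Bx]; first by exists x.
apply: cA => V /nbhs_prefix[m mV].
by have [y Ay yx] := Bx m Logic.I; exists y; split => //; exact: mV.
Qed.

(** The sets [B] such that [B] and its complement both have analytic preimages form a sigma-algebra
    containing the open sets. Complements are carried along because analyticity alone is not stable
    under them. *)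
Lemma analytic_preim_borel (T : ptopologicalType) (g : cantor_space -> T)
    (A : set (borelType T)) :
  continuous g -> measurable A -> analytic (g @^-1` A).
Proof.
move=> gc mA.
pose S := [set B : set T | analytic (g @^-1` B) /\ analytic (g @^-1` (~` B))].
suff : S A by case.
apply: (@smallest_sub _ (sigma_algebra setT) (@open T) S) => //.
- split.
  + split; first by apply: analytic_open; rewrite preimage_set0; exact: open0.
    apply: analytic_open; rewrite -preimage_setC preimage_set0 setC0.
    exact: openT.
  + by move=> B [B1 B2]; rewrite setTD; split => //; rewrite setCK.
  + move=> F SF; split.
      by rewrite preimage_bigcup; apply: analytic_bigcup => i; case: (SF i).
    rewrite setC_bigcup preimage_bigcap; apply: analytic_bigcap => i.
    by case: (SF i).
- move=> B oB; have ogB : open (g @^-1` B) by apply: open_preimage oB.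
  split; first exact: analytic_open.
  by rewrite -preimage_setC; apply: analytic_closed; exact: open_closedC.
Qed.

(** * An analytic set with a non-analytic complement *)

(* Cantor's diagonal: [x] is read as a code of a sequence of open sets. *)
Definition diag (n : nat) : set (cantor_space * cantor_space) :=
  [set p : cantor_space * cantor_space | exists m,
    p.1 (pickle (n, mkseq p.1 m, mkseq p.2 m))].

Lemma open_diag n : open (diag n).
Proof.
apply/openP_prefix => p [m pm].
(* Length [m] preserves the two prefixes that enter the index [k]; length [k.+1] preserves the digit
   [k] itself. *)
set k := pickle _ in pm; exists (maxn m k.+1) => q q1 q2; exists m.
rewrite (mkseq_prefixW _ _ _ _ (leq_maxl _ _) q1).
rewrite (mkseq_prefixW _ _ _ _ (leq_maxl _ _) q2) -/k.
by rewrite (mkseq_ext _ _ _ _ q1) ?leq_maxr.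
Qed.

(** If open sets [U n] defined the complement, a code [c] of them would make [diag n] and [U n]
    agree on the pairs [(c, z)], so that [c] would be in the set exactly when it is not. *)
Lemma nonanalytic_diag :
  ~ analytic (~` [set x | exists z, forall n, diag n (x, z)]).
Proof.
move=> [U oU DU].
(* [c] accepts [(n, u, v)] exactly when the product of the cylinders of [u] and [v] lies inside
   [U n]. *)
pose c : cantor_space := fun k =>
  if unpickle k is Some (n, u, v) then
    `[< forall p : cantor_space * cantor_space, mkseq p.1 (size u) = u ->
      mkseq p.2 (size v) = v -> U n p >]
  else false.
have cU n p : U n p <-> exists m, c (pickle (n, mkseq p.1 m, mkseq p.2 m)).
  split.
    have /openP_prefix oUn := oU n => /oUn[m mU]; exists m.
    by rewrite /c pickleK !size_mkseq; apply/asboolP => q; exact: mU.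
  by move=> [m]; rewrite /c pickleK !size_mkseq => /asboolP; apply.
have : (~` [set x | exists z, forall n, diag n (x, z)]) c <->
  [set x | exists z, forall n, U n (x, z)] c by rewrite DU.
rewrite /= => -[h1 h2].
have h : (exists z, forall n, diag n (c, z)) <-> (exists z, forall n, U n (c, z)).
  by split=> -[z cz]; exists z => n; apply/cU; exact: cz.
have nD : ~ exists z, forall n, diag n (c, z) by move=> D; exact: (h2 (h.1 D) D).
exact: nD (h.2 (h1 nD)).
Qed.

(** * The ternary embedding of the Cantor space in the reals *)

(** With digits 0, 1 and weights starting at 1, this is 3/2 times the usual expansion with digits 0,
    2 of a point of the Cantor set. *)
Definition ternary_sum (R : realType) (x : cantor_space) : R^nat :=
  series (fun i => (x i)%:R * 3^-1 ^+ i).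

Definition ternary (R : realType) (x : cantor_space) : R :=
  limn (ternary_sum R x).

Lemma is_cvg_ternary_sum (R : realType) (x : cantor_space) :
  cvgn (ternary_sum R x).
Proof.
apply: (@series_le_cvg _ _ (geometric 1 3^-1)) => [n|n|n|].
- by rewrite mulr_ge0// exprn_ge0.
- by rewrite /= mulr_ge0// exprn_ge0.
- by rewrite /= ler_wpM2r ?exprn_ge0//; case: (x n).
- by apply: is_cvg_geometric_series; rewrite ger0_norm//; lra.
Qed.

Lemma ternary_ge0 (R : realType) (x : cantor_space) : 0 <= ternary R x.
Proof.
apply: limr_ge; first exact: is_cvg_ternary_sum.
by apply: nearW => n; apply: sumr_ge0 => i _; rewrite mulr_ge0// exprn_ge0.
Qed.

(** Digits differ by at most 1, and the powers of 1/3 with exponents from [n] to [n + k - 1] add up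
    to the right-hand side. *)
Lemma ternary_sum_tail (R : realType) (x y : cantor_space) n k :
  `|(ternary_sum R x (n + k)%N - ternary_sum R y (n + k)%N) -
    (ternary_sum R x n - ternary_sum R y n)| <=
  3 / 2 * (3^-1 ^+ n - 3^-1 ^+ (n + k)%N).
Proof.
elim: k => [|k IH]; first by rewrite addn0 !subrr normr0 mulr0.
rewrite addnS /ternary_sum !seriesSr -!/(ternary_sum _ _).
set q := 3^-1 ^+ (n + k)%N in IH *; have q0 : 0 <= q by rewrite exprn_ge0.
have -> : 3^-1 ^+ (n + k)%N.+1 = 3^-1 * q by rewrite exprS.
have : `|(x (n + k)%N)%:R * q - (y (n + k)%N)%:R * q| <= q.
  case: (x _); case: (y _); rewrite /= ?mulr1n ?mulr0n ?mul0r ?mul1r ?subrr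
    ?subr0 ?sub0r ?normrN ?normr0//;
  by rewrite ger0_norm.
move: IH; rewrite !ler_norml => /andP[h1 h2] /andP[h3 h4]; apply/andP; split; lra.
Qed.

Lemma ternary_tail (R : realType) (x y : cantor_space) n :
  `|(ternary R x - ternary R y) - (ternary_sum R x n - ternary_sum R y n)| <=
  3 / 2 * 3^-1 ^+ n.
Proof.
have cv : (fun k => `|(ternary_sum R x k - ternary_sum R y k) -
    (ternary_sum R x n - ternary_sum R y n)|) @ \oo -->
  `|(ternary R x - ternary R y) - (ternary_sum R x n - ternary_sum R y n)|.
  apply: cvg_norm; apply: cvgB; last exact: cvg_cst.
  by apply: cvgB; exact: is_cvg_ternary_sum.
rewrite -(cvg_lim _ cv)//; apply: limr_le.
  by apply/cvg_ex; eexists; exact: cv.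
exists n => // k /= nk; rewrite -(subnKC nk).
apply: le_trans (ternary_sum_tail _ _ _ _ _) _.
by rewrite ler_wpM2l// lerBlDr lerDl exprn_ge0.
Qed.

Lemma ternary_sum_prefix (R : realType) (x y : cantor_space) n :
  mkseq x n = mkseq y n -> ternary_sum R x n = ternary_sum R y n.
Proof.
move=> xy; rewrite /ternary_sum /series /= !big_mkord; apply: eq_bigr => i _.
by rewrite (mkseq_ext _ _ _ _ xy).
Qed.

(** At the first index [n] where the digits differ, the partial sums separate by 3^-n, and the tails
    beyond it can make up at most half of that. *)
Lemma ternary_inj (R : realType) : injective (ternary R).
Proof.
move=> x y xy; apply: contrapT => nxy.
have ex : exists n, x n != y n.
  apply: contrapT => /forallNP h; apply: nxy; apply/funext => n.
  by apply/eqP; apply: contrapT => /negP; exact: h.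
have nP := ex_minnP ex; case: nP => n xyn minn.
have xyp : mkseq x n = mkseq y n.
  apply/eq_in_map => i; rewrite mem_iota => /andP[_ /= im].
  by apply/eqP; apply: contraTT im => /minn; rewrite -leqNgt.
have := ternary_tail R x y n.+1.
rewrite xy subrr sub0r normrN /ternary_sum !seriesSr -!/(ternary_sum _ _).
rewrite (ternary_sum_prefix _ _ _ _ xyp) exprS.
have q0 : 0 < (3^-1 : R) ^+ n by rewrite exprn_gt0.
by move: xyn; case: (x n); case: (y n) => // _;
  rewrite ler_norml => /andP[] /=; lra.
Qed.

Lemma ternary_continuous (R : realType) : continuous (ternary R).
Proof.
move=> x; apply/cvgrPdist_le => e e0.
have q0 : (fun n => 3 / 2 * 3^-1 ^+ n : R) @ \oo --> 0.
  by apply: cvg_geometric; rewrite ger0_norm//; lra.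
have [n _ /(_ n (leqnn n)) /= qe] : \forall n \near \oo,
  `|3 / 2 * 3^-1 ^+ n : R| <= e := cvgr0_norm_le _ q0 _ e0.
apply: filterS (near_prefix x n) => y yx.
have := ternary_tail R x y n; rewrite (ternary_sum_prefix _ _ _ _ yx) subrr subr0.
move=> /le_trans; apply; apply: le_trans qe; exact: ler_norm.
Qed.

(** * Indicators of Baire class one and two *)

Lemma baire_class1_closed (R : realType) (A : set (R * R)) :
  closed A -> baire_class 1 (\1_A : R * R -> R).
Proof.
(* The distance to the empty set is infinite; [fine] would turn it into 0 and make [h] equal to 1
   everywhere. *)
move=> cA; have [->|/set0P[a Aa]] := eqVneq A set0.
  exists (fun _ _ => 0) => [k|x]; first exact: cst_continuous.
  by rewrite indic0; exact: cvg_cst.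
have dfin x : edist_inf A x \is a fin_num.
  rewrite ge0_fin_numE ?edist_inf_ge0 //; apply: (@le_lt_trans _ _ (edist (x, a))).
    by apply: ereal_inf_lbound; exists a.
  rewrite -ge0_fin_numE ?edist_ge0 //; apply/edist_finP.
  exists (`|x - a| + 1); first by rewrite ltr_wpDl.
  by rewrite -ball_normE /= ltrDl.
(* Powers of [h] converge to the indicator: [h] is 1 on [A], and [0 <= h < 1]
   elsewhere. *)
pose h x := 1 - Num.min (fine (edist_inf A x)) 1.
have h01 x : 0 <= h x <= 1.
  rewrite subr_ge0 ge_min lexx orbT lerBlDr lerDl le_min ler01 andbT.
  by rewrite fine_ge0// edist_inf_ge0.
have hc : continuous h.
  move=> x; apply: cvgB; first exact: cvg_cst.
  apply: (@continuous_min _ _ (fine \o edist_inf A) (cst 1)); last exact: cvg_cst.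
  by apply: fine_cvg; rewrite fineK//; exact: edist_inf_continuous.
exists (fun k x => h x ^+ k) => [k x|x].
  exact: (continuous_comp (hc x) (@exprn_continuous _ k (h x))).
rewrite indicE; have [/set_mem Ax|/negP nAx] := boolP (x \in A).
  rewrite /h edist_inf0// fine0 min_l// subr0.
  by under eq_fun do rewrite expr1n; exact: cvg_cst.
apply: cvg_expr; have /andP[h0 _] := h01 x; rewrite ger0_norm//.
rewrite ltrBlDr ltrDl lt_min ltr01 andbT.
rewrite lt_neqAle fine_ge0 ?edist_inf_ge0// andbT.
(* A point at distance 0 from [A] is in its closure, hence in [A]. *)
apply/negP => /eqP d0; apply: nAx; apply/mem_set/cA => V.
move=> /nbhs_ballP[e /= e0 eV].
have : (edist_inf A x < e%:E)%E by rewrite -(fineK (dfin x)) -d0 lte_fin.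
move=> /ereal_inf_lt[_ [b Ab <-]] /edist_lt_ball bxe.
by exists b; split => //; exact: eV.
Qed.

Lemma baire_class1_setC (R : realType) (A : set (R * R)) :
  baire_class 1 (\1_A : R * R -> R) -> baire_class 1 (\1_(~` A) : R * R -> R).
Proof.
move=> [u uc uA]; exists (fun k x => 1 - u k x) => [k x|x].
  by apply: cvgB; [exact: cvg_cst|exact: uc].
rewrite indicE in_setC (_ : (~~ _)%:R = 1 - (\1_A x : R)).
  by apply: cvgB; [exact: cvg_cst|exact: uA].
by rewrite indicE; case: (x \in A); rewrite ?subrr ?subr0.
Qed.

Lemma baire_class1_setI (R : realType) (A B : set (R * R)) :
  baire_class 1 (\1_A : R * R -> R) -> baire_class 1 (\1_B : R * R -> R) ->
  baire_class 1 (\1_(A `&` B) : R * R -> R).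
Proof.
move=> [u uc uA] [v vc vB]; exists (fun k x => u k x * v k x) => [k x|x].
  by apply: cvgM; [exact: uc|exact: vc].
rewrite (_ : \1_(A `&` B) x = (\1_A x : R) * \1_B x).
  by apply: cvgM; [exact: uA|exact: vB].
by rewrite indicI.
Qed.

(** Finite intersections stay in class one, and at each point their indicators are eventually
    constant. *)
Lemma baire_class2_bigcap (R : realType) (F : nat -> set (R * R)) :
  (forall n, baire_class 1 (\1_(F n) : R * R -> R)) ->
  baire_class 2 (\1_(\bigcap_n F n) : R * R -> R).
Proof.
move=> bF.
exists (fun n => \1_(\big[setI/setT]_(i < n.+1) F i)) => [n|x].
  elim: n => [|n IH]; first by rewrite big_ord1.
  by rewrite big_ord_recr; exact: baire_class1_setI.
apply: cvg_near_cst.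
have [Fx|] := pselect ((\bigcap_n F n) x).
  by apply: nearW => n; rewrite !indicE !mem_set// -bigcap_mkord => i _; exact: Fx.
move=> nFx; have [i nFi] : exists i, ~ F i x.
  by apply: contrapT => /forallNP h; apply: nFx => i _; exact: contrapT (h i).
by exists i => // n /= ni; rewrite !indicE !memNset// -bigcap_mkord => /(_ i ni).
Qed.

(** * A G_delta set in the plane and its indicator, the payoff *)

(** The coordinates are swapped: the witness becomes the strategy, and the projected point the place
    of the Dirac mass. *)
Definition plane_embedding (R : realType)
    (p : cantor_space * cantor_space) : R * R :=
  (ternary R p.2, ternary R p.1).

(** Closed sets are compact here, and so are their continuous images. *)
Lemma closed_plane_embedding (R : realType)
    (A : set (cantor_space * cantor_space)) :
  closed A -> closed (plane_embedding R @` A).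
Proof.
move=> cA; apply: compact_closed; first exact: norm_hausdorff.
apply: continuous_compact.
  apply: continuous_subspaceT; apply: continuous_pair.
    exact: continuous_comp_snd (@ternary_continuous R).
  exact: continuous_comp_fst (@ternary_continuous R).
have cX := compact_setX cantor_space_compact cantor_space_compact.
by apply: subclosed_compact cA cX _ => p _; split.
Qed.

(** By injectivity this is the image of [diag n]; written as a difference of two closed sets, it has
    an indicator of class one. *)
Definition winning (R : realType) (n : nat) : set (R * R) :=
  plane_embedding R @` setT `&` ~` (plane_embedding R @` (~` diag n)).

Definition payoff (R : realType) : R * R -> R := \1_(\bigcap_n winning R n).

Lemma baire_class2_payoff (R : realType) : baire_class 2 (payoff R).
Proof.
apply: baire_class2_bigcap => n; apply: baire_class1_setI.
  by apply: baire_class1_closed; exact: closed_plane_embedding closedT.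
apply: baire_class1_setC; apply: baire_class1_closed.
by apply: closed_plane_embedding; apply: open_closedC; exact: open_diag.
Qed.

Lemma winning_bigcapP (R : realType) (t : R) (x : cantor_space) :
  (\bigcap_n winning R n) (t, ternary R x) <->
  exists2 z, ternary R z = t & forall n, diag n (x, z).
Proof.
split=> [w|[z <- xz] n _].
  (* The [z] found for index 0 serves every [n], since [winning R n] excludes the images of pairs
     outside [diag n]. *)
  have [[[x' z] _ [zt /ternary_inj xx'] _]] := w 0 Logic.I; subst x'.
  exists z => // n; apply: contrapT => nxz; have [_] := w n Logic.I.
  by apply; exists (x, z) => //=; rewrite /plane_embedding zt.
split; first by exists (x, z).
by move=> [[x' z'] /= nxz [/ternary_inj zz /ternary_inj xx]]; subst; exact: nxz.
Qed.

Lemma measurable_winning (R : realType) :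
  measurable (\bigcap_n winning R n : set (borelType (R * R)%type)).
Proof.
have cm (A : set (R * R)) : closed A -> measurable (A : set (borelType (R * R)%type)).
  move=> cA; rewrite -[A]setCK; apply: measurableC; apply: sub_sigma_algebra.
  exact: closed_openC.
apply: bigcapT_measurable => n; apply: measurableI.
  by apply: cm; exact: closed_plane_embedding closedT.
apply: measurableC; apply: cm; apply: closed_plane_embedding.
by apply: open_closedC; exact: open_diag.
Qed.

(** * Dirac measures and the best response relation *)

Lemma Rintegral_dirac d (T : measurableType d) (R : realType) (a : T)
    (f : T -> R) : measurable_fun setT f -> \int[\d_a]_y f y = f a.
Proof.
move=> mf; rewrite /Rintegral integral_dirac//; last exact/measurable_EFinP.
by rewrite diracT mul1e.
Qed.

Definition dirac_measure (R : realType) (a : R) : Delta R :=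
  (@dirac _ (measurableTypeR R) a R : probability (measurableTypeR R) R).

(** The weak topology only tests integrals of bounded continuous [f], and at the Dirac mass at [a]
    these are [f a]. *)
Lemma dirac_measure_continuous (R : realType) : continuous (dirac_measure R).
Proof.
apply: continuous_comp_initial; apply: continuous_ptws => -[f [fc fb]].
rewrite (_ : (fun _ => _) = f)//; apply/funext => a /=.
by rewrite /integral_ev Rintegral_dirac//; exact: continuous_measurable_fun.
Qed.

Lemma measurable_fun_borelType (R : realType) (U : ptopologicalType) (g : R -> U) :
  continuous g -> measurable_fun setT (g : measurableTypeR R -> borelType U).
Proof.
move=> gc; apply: (@measurability _ _ (measurableTypeR R) (borelType U) setT g
  (@open U)) => // _ [V oV <-].
by rewrite setTI; apply: open_measurable; exact: open_preimage.
Qed.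

Lemma measurable_payoff (R : realType) :
  measurable_fun [set: borelType (R * R)%type]
    (payoff R : _ -> measurableTypeR R).
Proof. apply: measurable_indic; exact: measurable_winning. Qed.

Lemma expected_payoff_dirac (R : realType) (t a : R) :
  expected_payoff (payoff R) t (dirac_measure R a) = payoff R (t, a).
Proof.
rewrite /expected_payoff Rintegral_dirac//.
apply: measurableT_comp (measurable_payoff R) _.
apply: measurable_fun_borelType; apply: continuous_pair => y.
  exact: cvg_cst.
exact: cvg_id.
Qed.

Theorem proposition7p17 (R : realType) :
  exists f : R * R -> R,
    [/\ bounded_fun f,
        measurable_fun [set: borelType (R * R)%type] (f : _ -> measurableTypeR R),
        baire_class 2 f
      & ~ measurable (best_response f : set (borelType (R * Delta R)%type))].
Proof.
exists (payoff R); split.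
- exists 1; split=> // M M1 p _ /=.
  rewrite /payoff indicE ger0_norm//; apply: le_trans (ltW M1).
  by rewrite lern1; case: (_ \in _).
- exact: measurable_payoff.
- exact: baire_class2_payoff.
(* Strategies that can earn 1 are values of [ternary], hence nonnegative, so [-1] earns 0
   throughout. A Borel relation would have an analytic preimage under [g]. *)
pose g (x : cantor_space) : R * Delta R := (-1, dirac_measure R (ternary R x)).
have gc : continuous g.
  apply: continuous_pair => x; first exact: cvg_cst.
  apply: continuous_comp; first exact: ternary_continuous.
  exact: dirac_measure_continuous.
move=> /(analytic_preim_borel _ g _ gc).
rewrite (_ : _ @^-1` _ = ~` [set x | exists z, forall n, diag n (x, z)]).
  exact: nonanalytic_diag.
have payoffN1 a : payoff R (-1, ternary R a) = 0.
  rewrite /payoff indicE memNset// => /winning_bigcapP[z zN1].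
  by have := ternary_ge0 R z; rewrite zN1; lra.
apply/seteqP; split=> x /=; rewrite /best_response /=.
  (* A witness [z] would let the strategy [ternary R z] earn 1 and beat [-1]. *)
  move=> br [z xz]; have := br (ternary R z).
  rewrite !expected_payoff_dirac payoffN1 /payoff indicE mem_set ?ler10//.
  by apply/winning_bigcapP; exists z.
(* Without a witness every strategy earns 0. *)
move=> nx t; rewrite !expected_payoff_dirac payoffN1 /payoff indicE memNset//.
by move=> /winning_bigcapP[z _ xz]; apply: nx; exists z.
Qed.
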